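(* Let $G$ be a finite directed multigraph and let $\mathcal D$ be a source-factorizable DAG assignment on $G$. For all subsets $S\subseteq U\subseteq G_V$, $$w(\mathcal D_S(U))=\sum_{\Gamma\in\mathcal C(S,U)}\ \prod_{\ell=1}^{L(\Gamma)}\Bigl((-1)^{|\Gamma_\ell\setminus\Gamma_{\ell-1}|-1}A(\Gamma_\ell\setminus\Gamma_{\ell-1},\Gamma_\ell)\Bigr)=\sum_{\Gamma\in\mathcal C(S,U)}(-1)^{|U\setminus S|-L(\Gamma)}\prod_{\ell=1}^{L(\Gamma)}A(\Gamma_\ell\setminus\Gamma_{\ell-1},\Gamma_\ell),$$ where $\mathcal C(S,U)$ is the set of strictly increasing chains from $S$ to $U$ in the power set of $G_V$.
   Context: $G=(G_V,G_E)$ is a finite directed multigraph (loops and parallel edges allowed); each edge $e$ has a source $s(e)$ and a target $t(e)$ in $G_V$. A subgraph $H=(H_V,H_E)$ has $H_V\subseteq G_V$, $H_E\subseteq G_E$, with inherited sources and targets; $H$ is ''on $U$'' if $H_V=U$. For $T\subseteq H_V$, $H|_T$ is the subgraph on $T$ consisting of all edges of $H$ with both source and target in $T$. For subgraphs $H,H'$ with disjoint edge sets, $H'\star H$ is the subgraph with vertex set $H'_V\cup H_V$ and edge set $H'_E\sqcup H_E$. A DAG is a directed graph with no closed walk of length $\ge1$. $\mathsf{Snk}(H)$ is the set of vertices of out-degree $0$ in $H$; $\mathsf{Src}(H)$ is the set of vertices of in-degree $0$; $\mathsf{Nss}(H)=\mathsf{Src}(H)\setminus\mathsf{Snk}(H)$.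 Weights: $R_{G_E}=\mathbb Z[x_e:e\in G_E]$; $w(H)=\prod_{e\in H_E}x_e$ for a subgraph $H$, and $w(\mathcal S)=\sum_{H\in\mathcal S}w(H)$ for a set $\mathcal S$ of subgraphs. For $U\subseteq G_V$, $\mathsf{DAG}(U)$ is the set of acyclic subgraphs of $G$ on $U$. A DAG assignment $\mathcal D$ on $G$ assigns to each $U\subseteq G_V$ a subset $\mathcal D(U)\subseteq\mathsf{DAG}(U)$. For $T\subseteq U\subseteq G_V$ let $\mathcal B(T,U)=\{H\in\mathcal D(U):T\subseteq\mathsf{Nss}(H)\}$. For $H\in\mathcal D(U\setminus T)$, let $\mathcal A_H(T,U)\subseteq\mathsf{DAG}(U)$ be the set of graphs $H'$ on $U$ all of whose edges have source in $T$ and target in $U\setminus T$ and such that $H'\star H\in\mathcal B(T,U)$. $\mathcal D$ is source-factorizable if for all $T\subseteq U\subseteq G_V$: (i) for each $H\in\mathcal B(T,U)$, $H|_{U\setminus T}\in\mathcal D(U\setminus T)$; (ii) all $H\in\mathcal D(U\setminus T)$ induce the same set $\mathcal A_H(T,U)$; (iii) $\mathcal D(U)$ contains the edgeless graph on $U$. In this case $\mathcal A(T,U)$ denotes the common set $\mathcal A_H(T,U)$, and $A(T,U)=w(\mathcal A(T,U))$. Also $\mathcal D_S(U)=\{H\in\mathcal D(U):\mathsf{Snk}(H)=S\}$. Chains: in a poset $P$, a strictly increasing chain of length $L(\Gamma)=d\in\mathbb N$ from $b$ to $c$ is a tuple $\Gamma=(\Gamma_0,\dots,\Gamma_d)$ with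 $\Gamma_0=b$, $\Gamma_d=c$ and $\Gamma_{i-1}<\Gamma_i$ for all $i$; $d=0$ is allowed when $b=c$. Here $P$ is the power set of $G_V$ ordered by inclusion. Empty products equal $1$. *)

(* Defs.v *)
From HB Require Import structures.
From mathcomp Require Import all_boot all_order all_algebra.
From mathcomp Require Import mpoly.

Set Implicit Arguments.
Unset Strict Implicit.
Unset Printing Implicit Defensive.

Import GRing.Theory.
Local Open Scope ring_scope.

Record digraph := Digraph {
  vertex : finType;
  edge : finType;
  src : edge -> vertex;
  tgt : edge -> vertex }.

Definition incident (G : digraph) (VE : {set vertex G} * {set edge G}) : bool :=
  [forall e in VE.2, (src e \in VE.1) && (tgt e \in VE.1)].

Record subgraph (G : digraph) := Subgraph {
  subgraph_val :> {set vertex G} * {set edge G};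
  _ : incident subgraph_val }.

HB.instance Definition _ (G : digraph) := [isSub for @subgraph_val G].
HB.instance Definition _ (G : digraph) := [Finite of subgraph G by <:].

Section Subgraphs.
Variable G : digraph.
Implicit Types (H : subgraph G) (S T U : {set vertex G}).

Definition vset H : {set vertex G} := (H : _ * _).1.
Definition eset H : {set edge G} := (H : _ * _).2.

Lemma incident_edge H e : e \in eset H -> (src e \in vset H) && (tgt e \in vset H).
Proof. by case: H => VE inc; rewrite /eset /vset /=; move/forall_inP: inc; apply. Qed.

Lemma edgeless_subproof U : incident (U, set0 : {set edge G}).
Proof. by apply/forall_inP => e; rewrite inE. Qed.

Definition edgeless U : subgraph G := Subgraph (edgeless_subproof U).

Lemma restrict_subproof T H :
  incident (T, [set e in eset H | (src e \in T) && (tgt e \in T)]).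
Proof. by apply/forall_inP => e; rewrite inE => /andP[]. Qed.

Definition restrict T H : subgraph G := Subgraph (restrict_subproof T H).

Lemma star_subproof H' H : incident (vset H' :|: vset H, eset H' :|: eset H).
Proof.
apply/forall_inP => e; rewrite !inE.
by case/orP => /incident_edge/andP[-> ->]; rewrite ?orbT.
Qed.

(* The star product as a total operation; it is only applied below to subgraphs whose edge
   sets are disjoint (see [Aset_disjoint]). *)
Definition star H' H : subgraph G := Subgraph (star_subproof H' H).

(* A closed walk of length [size p], given by its cyclic sequence of edges. *)
Definition closed_walk H (p : seq (edge G)) : bool :=
  all (fun e => e \in eset H) p && cycle (fun e f => tgt e == src f) p.

Definition acyclic H : Prop :=
  forall p : seq (edge G), closed_walk H p -> size p = 0%N.

(* Decision procedure for [acyclic], needed to form finite sets of DAGs. *)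
Definition walk_step H : rel (edge G) :=
  fun e f => [&& e \in eset H, f \in eset H & tgt e == src f].

Definition acyclicb H : bool :=
  [forall e, forall f, walk_step H e f ==> ~~ connect (walk_step H) f e].

Lemma cycle_walk_step H p : cycle (walk_step H) p = closed_walk H p.
Proof.
rewrite /closed_walk; case: p => [|e p] //=.
have pathE x q : path (walk_step H) x q =
    ((x \in eset H) || nilp q) && all (fun e => e \in eset H) q
      && path (fun e f => tgt e == src f) x q.
  elim: q x => [|y q IH] x /=; first by rewrite orbT.
  rewrite IH orbF /walk_step.
  by case: (x \in _) => //=; case: (y \in _); case: (_ == _); rewrite //= andbF.
rewrite pathE all_rcons /nilp size_rcons /= orbF.
by case: (e \in _).
Qed.

Lemma acyclicP H : reflect (acyclic H) (acyclicb H).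
Proof.
apply: (iffP idP) => [acyH p | acyH].
  rewrite -cycle_walk_step; case: p => [//|e p] /=.
  rewrite rcons_path => /andP[ep pe]; exfalso.
  have /forallP/(_ (last e p))/forallP/(_ e) := acyH.
  by rewrite pe /= => /negP; apply; apply/connectP; exists p.
apply/forallP => e; apply/forallP => f; apply/implyP => ef; apply/negP.
case/connectP => q fq eE; have := acyH (f :: q).
rewrite -cycle_walk_step /= rcons_path fq -eE ef => /(_ isT).
by [].
Qed.

Definition Snk H : {set vertex G} :=
  [set v in vset H | #|[set e in eset H | src e == v]| == 0%N].

Definition Src H : {set vertex G} :=
  [set v in vset H | #|[set e in eset H | tgt e == v]| == 0%N].

Definition Nss H : {set vertex G} := Src H :\: Snk H.

Definition DAG U : {set subgraph G} := [set H | (vset H == U) && acyclicb H].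

End Subgraphs.

Section Assignments.
Variable G : digraph.
Implicit Types (H : subgraph G) (S T U : {set vertex G}).
Variable D : {set vertex G} -> {set subgraph G}.

Definition dag_assignment : Prop := forall U, D U \subset DAG U.

Definition Bset T U : {set subgraph G} := [set H in D U | T \subset Nss H].

Definition Aset_of H T U : {set subgraph G} :=
  [set H' in DAG U |
    [forall e in eset H', (src e \in T) && (tgt e \in U :\: T)]
    && (star H' H \in Bset T U)].

Definition source_factorizable : Prop :=
  (forall T U, T \subset U ->
     (forall H, H \in Bset T U -> restrict (U :\: T) H \in D (U :\: T))
     /\ (forall H1 H2, H1 \in D (U :\: T) -> H2 \in D (U :\: T) ->
           Aset_of H1 T U = Aset_of H2 T U)
     /\ edgeless U \in D U).

(* The common value of the [Aset_of H T U], read off at the edgeless element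
   of [D (U :\: T)]; see [Aset_common]. *)
Definition Aset T U : {set subgraph G} := Aset_of (edgeless (U :\: T)) T U.

Lemma Aset_common H T U :
  source_factorizable -> T \subset U -> H \in D (U :\: T) ->
  Aset_of H T U = Aset T U.
Proof.
move=> sfD TU HD; have [_ [AE _]] := sfD T U TU; apply: AE => //.
by have [_ []] := sfD _ _ (subxx (U :\: T)).
Qed.

Lemma Aset_disjoint H H' T U :
  dag_assignment -> H \in D (U :\: T) -> H' \in Aset_of H T U ->
  [disjoint eset H' & eset H].
Proof.
move=> dagD /(subsetP (dagD _)); rewrite inE => /andP[/eqP HU _].
rewrite inE => /and3P[_ /forall_inP H'T _].
apply/pred0P => e /=; apply/negbTE/andP => -[/H'T/andP[eT _] /incident_edge].
by rewrite HU !inE eT.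
Qed.

Definition D_Snk S U : {set subgraph G} := [set H in D U | Snk H == S].

End Assignments.

Section Weights.
Variable G : digraph.

(* Z[x_e : e in G_E], with the edges numbered by [enum_rank]. *)
Definition RE : comNzRingType := {mpoly int[#|edge G|]}.

Definition xvar (e : edge G) : RE := 'X_(enum_rank e).

Definition wt (H : subgraph G) : RE := \prod_(e in eset H) xvar e.

Definition wts (X : {set subgraph G}) : RE := \sum_(H in X) wt H.

Definition A (D : {set vertex G} -> {set subgraph G}) (T U : {set vertex G}) : RE :=
  wts (Aset D T U).

End Weights.

Section Chains.
Variable V : finType.
Implicit Types (S U : {set V}) (g : seq {set V}).

Definition is_chain S U g : bool :=
  [&& g != [::], head set0 g == S, last set0 g == U
    & sorted (fun X Y : {set V} => X \proper Y) g].

(* Tuples (Gamma_0, ..., Gamma_d) with d <= #|V|; by [chainsP] the bound on d,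
   which makes the type finite, loses no strictly increasing chain. *)
Definition tuples_of_sets : finType :=
  {d : 'I_#|V|.+1 & d.+1.-tuple {set V}}.

Definition chain_seq (c : tuples_of_sets) : seq {set V} := tagged c.
Definition chain_length (c : tuples_of_sets) : nat := tag c.
Definition chain_at (c : tuples_of_sets) (i : nat) : {set V} := nth set0 (chain_seq c) i.

Definition chains S U : {set tuples_of_sets} :=
  [set c | is_chain S U (chain_seq c)].

Lemma size_chain_seq c : size (chain_seq c) = (chain_length c).+1.
Proof. exact: size_tuple. Qed.

Lemma chain_seq_inj : injective chain_seq.
Proof.
move=> [d1 t1] [d2 t2] t12; have d12 : d1 = d2.
  by apply: val_inj; apply: succn_inj; rewrite -(size_tuple t1) -(size_tuple t2);
     congr size.
by subst d2; congr existT; apply: val_inj.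
Qed.

Lemma sorted_card g X :
  path (fun X Y : {set V} => X \proper Y) X g ->
  (X \subset last X g) && (size g + #|X| <= #|last X g|)%N.
Proof.
elim: g X => [|Y g IH] X /=; first by rewrite subxx leqnn.
case/andP => XY /IH/andP[Yl cl].
rewrite (subset_trans (proper_sub XY) Yl) (leq_trans _ cl) //.
by rewrite addSnnS leq_add2l proper_card.
Qed.

Lemma chainsP S U g :
  reflect (exists2 c, c \in chains S U & chain_seq c = g) (is_chain S U g).
Proof.
apply: (iffP idP) => [chg | [c]]; last by rewrite inE => ? <-.
have gV : (size g <= #|V|.+1)%N.
  case: g chg => // X g /and4P[_ _ _ /sorted_card/andP[_ cl]] /=.
  by rewrite ltnS; apply: leq_trans (leq_trans cl (max_card _)); apply: leq_addr.
have gn0 : (0 < size g)%N by case: g chg {gV} => //; rewrite /is_chain.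
have dP : ((size g).-1 < #|V|.+1)%N by rewrite prednK.
have sP : size g == (size g).-1.+1 by rewrite prednK.
exists (@existT _ (fun d : 'I_#|V|.+1 => d.+1.-tuple {set V}) (Ordinal dP) (Tuple sP)) => //.
by rewrite inE.
Qed.

(* Hence the truncated subtractions in the exponents of -1 below are genuine. *)
Lemma chain_length_le S U c :
  c \in chains S U -> (chain_length c <= #|U :\: S|)%N.
Proof.
rewrite inE -ltnS -size_chain_seq; case: (chain_seq c) => // X g.
case/and4P=> _ /= /eqP <- /eqP <- /sorted_card/andP[Xl].
by rewrite ltnS cardsDS // => cl; rewrite -(leq_add2r #|X|) subnK ?subset_leq_card.
Qed.

End Chains.

(* Main.v *)
Require Import Defs.
From HB Require Import structures.
From mathcomp Require Import all_boot all_order all_algebra.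
From mathcomp Require Import mpoly zify.

Set Implicit Arguments.
Unset Strict Implicit.
Unset Printing Implicit Defensive.

Import GRing.Theory.
Local Open Scope ring_scope.

(** The theorem unrolls the recursion, for [S] a proper subset of [U],
[[
w(D_S(U)) = \sum_(S <= X < U) (-1)^(|U \ X| - 1) A(U \ X, U) w(D_S(X)),
]]
with [w(D_U(U)) = 1], the only DAG on [U] in which every vertex is a sink being
the edgeless one.

The recursion ([wts_D_Snk_rec]) is an inclusion-exclusion over sources.  A DAG
[H] with sink set [S] different from [U] has an edge, and following edges
backwards reaches a source that is not a sink, so [Nss H] is a nonempty subset
of [U \ S] ([Nss_neq0]).  The signs [(-1)^(|T| - 1)] over the nonempty subsets
[T] of [Nss H] therefore add up to [1], and [w(D_S(U))] is the sum, over
nonempty [T] and with these signs, of the weight of the [H] in [D_S(U)] with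
[T] contained in [Nss H].  Cutting such an [H] into the edges that leave [T] and
the restriction to [U \ T] inverts the star product, and changes no sink:
vertices of [T] emit an edge, and vertices outside [T] keep all their outgoing
edges since nothing enters [T].  Source-factorizability says precisely that the
two pieces range independently over [A(T, U)] and [D_S(U \ T)], so that weight
is [A(T, U) w(D_S(U \ T))] ([wts_D_Snk_sources]).  Take [X = U \ T].

On the other side, removing the last step of a chain shows that the sum over
chains satisfies the same recursion ([chain_sumS]), and such a recursion has only
one solution ([last_step_recursion_unique]).  The two forms of the chain sum
agree because the cardinals of the steps of a chain from [S] to [U] add up to
[|U \ S|] ([chain_sign_exponent]). *)

(** * Signed sums over subsets *)

Section AlternatingSums.
Variables (V : finType) (R : comNzRingType).
Implicit Types N S T U X : {set V}.

(** Expansion of the product of the [1 - [v in N]], which has a zero factor. *)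
Lemma sum_sign_subsets N :
  N != set0 -> \sum_(T : {set V} | T \subset N) (-1) ^+ #|T| = 0 :> R.
Proof.
case/set0Pn=> x xN.
have -> : \sum_(T : {set V} | T \subset N) (-1) ^+ #|T|
    = \prod_(v : V) (- (v \in N)%:R + 1) :> R.
  rewrite bigA_distr big_mkcond /=; apply: eq_bigr => T _.
  case: ifPn => [TN | /subsetPn[y yT yN]].
    rewrite -prodr_const big_mkcond /=; apply: eq_bigr => v _.
    by case: ifP => // vT; rewrite (subsetP TN).
  by rewrite (bigD1 y) //= yT (negbTE yN) oppr0 mul0r.
by rewrite (bigD1 x) //= xN addNr mul0r.
Qed.

Lemma sum_sign_nonempty_subsets N :
  N != set0 ->
  \sum_(T : {set V} | (T \subset N) && (T != set0)) (-1) ^+ (#|T| - 1)%N = 1 :> R.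
Proof.
move=> N0; have := sum_sign_subsets N0.
rewrite (bigD1 set0) ?sub0set //= cards0 expr0 => /eqP.
rewrite addrC addr_eq0 => /eqP sumE; apply: oppr_inj; rewrite -[RHS]sumE -sumrN.
apply: eq_bigr => T /andP[_]; rewrite -card_gt0.
by case: #|T| => // n _; rewrite subn1 exprS mulN1r.
Qed.

(** The previous sum in terms of [X = U \ T], the penultimate set of a chain
    ending at [U]. *)
Lemma sum_sign_complements S U N :
  S \subset U -> N != set0 -> N \subset U :\: S ->
  \sum_(X : {set V} | [&& S \subset X, X \proper U & U :\: X \subset N])
     (-1) ^+ (#|U :\: X| - 1)%N = 1 :> R.
Proof.
move=> SU N0 NUS; rewrite -[RHS](sum_sign_nonempty_subsets N0).
have NU : N \subset U := subset_trans NUS (subsetDl _ _).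
rewrite [RHS](reindex_onto (fun X => U :\: X) (fun T => U :\: T)) /=; last first.
  by move=> T /andP[TN _]; rewrite setDDr setDv set0U; apply/setIidPr/(subset_trans TN).
apply: eq_bigl => X; rewrite setDDr setDv set0U setD_eq0.
case UXN: (U :\: X \subset N); rewrite ?andbF //= andbT.
rewrite properE (sameP eqP setIidPr).
case XU: (X \subset U); rewrite ?andbF //= andbT.
case: (U \subset X) => /=; rewrite ?andbF // andbT.
apply/subsetP => x xS; apply: contraT => xX.
have /(subsetP UXN)/(subsetP NUS) : x \in U :\: X by rewrite inE xX (subsetP SU).
by rewrite inE xS.
Qed.
End AlternatingSums.

(** * Sums over chains of sets *)

Section ChainSums.
Variables (V : finType) (R : comNzRingType).
Variable a : {set V} -> {set V} -> R.
Implicit Types (S U X : {set V}) (g : seq {set V}).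

Definition chain_weight g : R :=
  \prod_(1 <= l < size g) a (nth set0 g l.-1) (nth set0 g l).

(** Fixing the number [d] of steps makes the index type one of tuples of a fixed
    length, among which removing the last step is a bijection. *)
Definition chain_sum d S U : R :=
  \sum_(t : d.+1.-tuple {set V} | is_chain S U t) chain_weight t.

Lemma is_chain_rcons S U g X :
  g != [::] ->
  is_chain S U (rcons g X) = [&& is_chain S (last set0 g) g, last set0 g \proper X & X == U].
Proof.
case: g => // Y g _; rewrite /is_chain /= last_rcons rcons_path eqxx /=.
by case: (Y == S); case: (X == U) => //=; rewrite ?andbF ?andbT.
Qed.

Lemma chain_weight_rcons g X :
  g != [::] -> chain_weight (rcons g X) = chain_weight g * a (last set0 g) X.
Proof.
move=> g0; have gP : (0 < size g)%N by case: g g0.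
rewrite /chain_weight size_rcons big_nat_recr //=; congr (_ * a _ _).
- apply: eq_big_nat => l /andP[l0 lg].
  by rewrite !nth_rcons lg (leq_ltn_trans (leq_pred l) lg).
- by rewrite nth_rcons prednK // leqnn nth_last.
- by rewrite nth_rcons ltnn eqxx.
Qed.

Lemma chain_sum0 S U : chain_sum 0 S U = (S == U)%:R.
Proof.
rewrite /chain_sum (reindex (fun X => [tuple X])) /=; last first.
  exists (@thead 0 _) => [X _ | t _]; first by rewrite theadE.
  by case/tupleP: t => X t; rewrite tuple0 theadE.
under eq_bigl => X do rewrite /is_chain /= andbT.
under eq_bigr => X _ do rewrite /chain_weight big_geq //.
case: eqVneq => [<- | SU].
  rewrite (bigD1 S) ?eqxx //= big1 ?addr0 // => X /andP[/andP[/eqP-> _]].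
  by rewrite eqxx.
by rewrite big1 // => X /andP[/eqP XS /eqP XU]; case/eqP: SU; rewrite -XS.
Qed.

Lemma chain_sumS d S U :
  chain_sum d.+1 S U = \sum_(X : {set V} | X \proper U) chain_sum d S X * a X U.
Proof.
under eq_bigr => X _ do rewrite big_distrl.
rewrite /= pair_big_dep /= /chain_sum.
(* A tuple corresponds to itself without its last entry, paired with its new last
   entry, which is the index [X] of the outer sum. *)
rewrite (reindex_onto (fun p : {set V} * d.+1.-tuple {set V} => rcons_tuple p.2 U)
  (fun t => let q := belast_tuple (thead t) (behead_tuple t) in (last set0 q, q))) /=;
  last first.
  case/tupleP=> X t; rewrite theadE => /and4P[_ _ /eqP lU _].
  by apply: val_inj; rewrite /= -lU /= -lastI.
have t0 (t : d.+1.-tuple {set V}) : tval t != [::] by rewrite -size_eq0 size_tuple.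
have rconsK (t : d.+1.-tuple {set V}) :
    belast_tuple (thead (rcons_tuple t U)) (behead_tuple (rcons_tuple t U)) = t.
  by case/tupleP: t => Y s; apply: val_inj; rewrite /= belast_rcons /thead (tnth_nth set0).
apply: eq_big => [[X t] | [X t] /andP[_ /eqP[lX _]]] /=; last first.
  by rewrite chain_weight_rcons // -lX -[t in last _ t](congr1 val (rconsK t)).
rewrite rconsK (_ : belast _ _ = t); last exact: (congr1 val (rconsK t)).
rewrite is_chain_rcons // eqxx andbT xpair_eqE eqxx andbT.
by case: eqVneq => [<- | lX]; rewrite ?andbT ?andbF /is_chain ?(negbTE lX) ?andbF // andbC.
Qed.

Lemma is_chain_subset S U g : is_chain S U g -> S \subset U.
Proof.
by case: g => // X g /and4P[_ /eqP <- /eqP <- /sorted_card/andP[]].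
Qed.

Lemma chain_sum_eq0 d S U : ~~ (S \subset U) -> chain_sum d S U = 0.
Proof.
by move=> SU; rewrite /chain_sum big1 // => t /is_chain_subset; rewrite (negbTE SU).
Qed.

(** Each step of a chain enlarges the set, so the sum over all lengths is finite and
    any bound [n >= |U|] on the length will do; a free bound lets the induction pass
    from [U] to its proper subsets. *)
Lemma last_step_recursion_unique n S U (F : {set V} -> R) :
  (forall X, S \subset X -> X \subset U -> F X = if X == S then 1 else
     \sum_(Y : {set V} | (S \subset Y) && (Y \proper X)) F Y * a Y X) ->
  S \subset U -> (#|U| <= n)%N ->
  F U = \sum_(d < n.+1) chain_sum d S U.
Proof.
elim: n U => [|n IH] U Frec SU Un.
  have U0 : U = set0 by apply/eqP; rewrite -cards_eq0 -leqn0.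
  have S0 : S = set0 by apply/eqP; rewrite -subset0 -U0.
  by rewrite big_ord1 chain_sum0 Frec // U0 S0 eqxx.
rewrite big_ord_recl chain_sum0 Frec // eq_sym.
under [X in _ + X]eq_bigr => d _ do rewrite lift0 chain_sumS.
rewrite exchange_big /=.
have -> : \sum_(X : {set V} | X \proper U) \sum_(d < n.+1) chain_sum d S X * a X U =
   \sum_(X : {set V} | (S \subset X) && (X \proper U)) F X * a X U.
  rewrite [RHS]big_mkcondl; apply: eq_bigr => X XU; rewrite -big_distrl /=.
  case: ifPn => SX.
    rewrite -IH // => [Y SY YX|].
      exact: Frec SY (subset_trans YX (proper_sub XU)).
    by rewrite -ltnS (leq_trans (proper_card XU)).
  by rewrite big1 ?mul0r // => d _; apply: chain_sum_eq0.
case: eqVneq => [SU' | _]; last by rewrite add0r.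
by rewrite big1 ?addr0 // => X; rewrite -SU' => /andP[SX]; rewrite properE SX andbF.
Qed.

Lemma sum_chains S U :
  \sum_(c in chains S U) \prod_(1 <= l < (chain_length c).+1)
      a (chain_at c l.-1) (chain_at c l)
  = \sum_(d < #|V|.+1) chain_sum d S U.
Proof.
rewrite [RHS]sig_big_dep; apply: eq_big => [c | c _]; first by rewrite inE.
by rewrite /chain_weight size_tuple.
Qed.

(** The cardinals of the steps telescope to [|U :\: S|]; each step is nonempty, so
    none of the truncated subtractions on the left loses anything. *)
Lemma chain_sign_exponent S U (c : tuples_of_sets V) :
  c \in chains S U ->
  (\sum_(1 <= l < (chain_length c).+1) (#|chain_at c l :\: chain_at c l.-1| - 1)
   = #|U :\: S| - chain_length c)%N.
Proof.
move=> cC; have cL := chain_length_le cC; move: cC.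
rewrite inE => chc; have SU := is_chain_subset chc; case/and4P: chc => _ hS lU sc.
have step m : (m <= chain_length c)%N ->
    (\sum_(1 <= l < m.+1) (#|chain_at c l :\: chain_at c l.-1| - 1) + m + #|S| 
      = #|chain_at c m|)%N.
  elim: m => [|m IH] mL.
    by rewrite big_geq // /chain_at nth0 (eqP hS).
  have := sc; move=> /(sortedP set0)/(_ m).
  rewrite size_chain_seq ltnS => /(_ mL) pr.
  rewrite big_nat_recr //= cardsDS ?proper_sub //.
  by have := proper_card pr; have := IH (ltnW mL); rewrite /chain_at; lia.
have := step _ (leqnn _); rewrite cardsDS // -(eqP lU).
have -> : chain_at c (chain_length c) = last set0 (chain_seq c).
  by rewrite -nth_last size_chain_seq.
lia.
Qed.

End ChainSums.

(** * Sources and sinks of acyclic subgraphs *)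

Section Graphs.
Variable G : digraph.
Implicit Types (H : subgraph G) (S T U X : {set vertex G}).

Lemma subgraph_eq H1 H2 : vset H1 = vset H2 -> eset H1 = eset H2 -> H1 = H2.
Proof.
by move=> vE eE; apply: val_inj; apply: injective_projections.
Qed.

Lemma card_edges_eq0 H (P : pred (edge G)) :
  (#|[set e in eset H | P e]| == 0%N) = [forall e in eset H, ~~ P e].
Proof.
rewrite cards_eq0; apply/eqP/forall_inP => [/setP E e eH | noP].
  by have := E e; rewrite !inE; move: eH => /= -> /= ->.
by apply/setP => e; rewrite !inE; apply/negP => /andP[/noP/negbTE->].
Qed.

Lemma in_Snk H v :
  (v \in Snk H) = (v \in vset H) && [forall e in eset H, src e != v].
Proof. by rewrite inE card_edges_eq0. Qed.

Lemma in_Src H v :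
  (v \in Src H) = (v \in vset H) && [forall e in eset H, tgt e != v].
Proof. by rewrite inE card_edges_eq0. Qed.

Lemma Nss_subset H : Nss H \subset vset H :\: Snk H.
Proof. by apply: setSD; apply/subsetP => v; rewrite in_Src => /andP[]. Qed.

(** Among the edges of [H], one with the fewest ancestors leaves a source: an edge
    [f] entering its source would have strictly fewer ancestors, by acyclicity. *)
Lemma Nss_neq0 H : acyclicb H -> Snk H != vset H -> Nss H != set0.
Proof.
move=> acyH nSnk.
have [e0 e0H] : exists e, e \in eset H.
  apply/set0Pn; apply: contraNneq nSnk => E0; apply/eqP/setP => v.
  rewrite in_Snk andbC; case: forall_inP => // -[] e.
  by rewrite E0 inE.
pose anc e := [set f | connect (walk_step H) f e].
case: (@arg_minnP _ e0 (fun e => e \in eset H) (fun e => #|anc e|) e0H) => e eH emin.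
apply/set0Pn; exists (src e); rewrite inE in_Snk in_Src.
have /andP[-> _] /= := incident_edge eH.
apply/andP; split; first by apply/forall_inP => /(_ e eH); rewrite eqxx.
apply/forall_inP => f fH.
apply: contraTneq (emin f fH) => fe; rewrite -ltnNge.
have step : walk_step H f e by rewrite /walk_step fH eH fe eqxx.
apply/proper_card/properP; split.
  by apply/subsetP => g; rewrite !inE => /connect_trans; apply; apply: connect1.
exists e; first by rewrite inE connect0.
by rewrite inE; move/forallP/(_ f)/forallP/(_ e): acyH; rewrite step.
Qed.

Lemma Snk_eq_vset H : Snk H = vset H -> eset H = set0.
Proof.
move=> sE; apply/setP => e; rewrite inE; apply/negP => eH.
have /andP[] := incident_edge eH; rewrite -sE in_Snk => /andP[_ /forall_inP].
by move/(_ e eH); rewrite eqxx.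
Qed.

(** * Cutting a subgraph along a set of sources *)

Lemma out_part_subproof T H : incident (vset H, [set e in eset H | src e \in T]).
Proof. by apply/forall_inP => e; rewrite inE => /andP[/incident_edge]. Qed.

Definition out_part T H : subgraph G := Subgraph (out_part_subproof T H).

Lemma acyclicb_subset H H' : eset H' \subset eset H -> acyclicb H -> acyclicb H'.
Proof.
move=> sub /acyclicP acyH; apply/acyclicP => p /andP[pH' cp]; apply: acyH.
by rewrite /closed_walk cp andbT; apply/sub_all: pH' => e; apply: (subsetP sub).
Qed.

Lemma eset_star H' H : eset (star H' H) = eset H' :|: eset H.
Proof. by []. Qed.

Lemma vset_star T U H' H :
  vset H' = U -> vset H = U :\: T -> vset (star H' H) = U.
Proof.
rewrite {3}/vset /= -!/(vset _) => -> ->.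
by apply/setUidPl/subsetDl.
Qed.

(** An edge that does not leave [T] does not enter it either, the vertices of [T]
    being sources, so it survives in the restriction. *)
Lemma star_out_part_restrict T U H :
  vset H = U -> T \subset Src H ->
  star (out_part T H) (restrict (U :\: T) H) = H.
Proof.
move=> HU TN; apply: subgraph_eq.
  by rewrite (@vset_star T U) ?HU.
apply/setP => e; rewrite /eset /= -/(eset H) !inE.
case eH: (e \in eset H) => //=.
have /andP[sU tU] := incident_edge eH; rewrite -HU sU tU !andbT.
case: (src e \in T) => //=; apply: contraT => /negPn /(subsetP TN).
by rewrite in_Src => /andP[_ /forall_inP/(_ e eH)]; rewrite eqxx.
Qed.

Lemma out_part_star T U H' H :
  vset H' = U -> vset H = U :\: T -> (forall e, e \in eset H' -> src e \in T) ->
  out_part T (star H' H) = H'.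
Proof.
move=> H'U HU H'T; apply: subgraph_eq.
  by rewrite [RHS]H'U -[LHS]/(vset (star H' H)) (vset_star H'U HU).
apply/setP => e; rewrite inE eset_star inE.
case eH': (e \in eset H') => /=; first exact: H'T.
by apply/negP => /andP[/incident_edge]; rewrite HU inE => /andP[/andP[/negbTE->]].
Qed.

Lemma restrict_star T U H' H :
  vset H = U :\: T -> (forall e, e \in eset H' -> src e \in T) ->
  restrict (U :\: T) (star H' H) = H.
Proof.
move=> HU H'T; apply: subgraph_eq; first by rewrite HU.
apply/setP => e; rewrite in_set eset_star -HU in_setU.
case eH: (e \in eset H); first by rewrite incident_edge // orbT.
by apply/negP; rewrite orbF HU inE => /andP[/H'T ->].
Qed.

(** Vertices of [T] are sinks on neither side, and the edges of [H'] leave only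
    from [T], so the other vertices have the same outgoing edges on both sides. *)
Lemma Snk_star T U H' H :
  vset H' = U -> vset H = U :\: T -> (forall e, e \in eset H' -> src e \in T) ->
  T \subset Nss (star H' H) -> Snk (star H' H) = Snk H.
Proof.
move=> H'U HU H'T TN; apply/setP => v; rewrite !in_Snk.
rewrite (vset_star H'U HU).
rewrite HU inE; case vT: (v \in T) => /=.
  have := subsetP TN _ vT; rewrite inE => /andP[/negbTE vS _].
  by move: vS; rewrite in_Snk (vset_star H'U HU).
congr (_ && _); apply/forall_inP/forall_inP => noe e eH; first last.
  move: eH; rewrite eset_star inE => /orP[/H'T eT | /noe //].
  by apply: contraFneq vT => <-.
by apply: noe; rewrite eset_star inE eH orbT.
Qed.

Lemma wt_star H' H :
  [disjoint eset H' & eset H] -> wt (star H' H) = wt H' * wt H.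
Proof. by move=> dis; rewrite /wt -bigU //=; apply: eq_bigl => e; rewrite inE. Qed.

(** * The recursion on the weights *)

Variable D : {set vertex G} -> {set subgraph G}.
Hypotheses (dagD : dag_assignment D) (sfD : source_factorizable D).

Lemma dag_vset U H : H \in D U -> vset H = U.
Proof. by move/(subsetP (dagD U)); rewrite inE => /andP[/eqP]. Qed.

Lemma dag_acyclicb U H : H \in D U -> acyclicb H.
Proof. by move/(subsetP (dagD U)); rewrite inE => /andP[]. Qed.

(** The star product is a weight-preserving bijection onto the left-hand index set
    from pairs in [A(T, U)] and [D_S(U \ T)].  That the pairs form a full product is
    where the independence of [Aset_of H T U] from [H] enters. *)
Lemma wts_D_Snk_sources S T U :
  T \subset U ->
  \sum_(H in D_Snk D S U | T \subset Nss H) wt H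
    = A D T U * wts (D_Snk D S (U :\: T)).
Proof.
move=> TU; rewrite /A /wts big_distrlr pair_big /=.
rewrite (reindex_onto (fun p : subgraph G * subgraph G => star p.1 p.2)
  (fun H => (out_part T H, restrict (U :\: T) H))) /=; last first.
  move=> H /andP[]; rewrite inE => /andP[/dag_vset HU _] /subset_trans TN.
  by apply: star_out_part_restrict => //; apply/TN/subsetDl.
apply: eq_big => [[H' H] | [H' H]] /=; last first.
  case/andP=> _ /eqP[H'E HE]; apply/wt_star/pred0P => e /=; apply/negP.
  rewrite -[in eset H']H'E -[in eset H]HE !inE => /andP[/andP[_ eT]].
  by rewrite eT andbF.
apply/idP/idP.
  case/andP=> /andP[]; rewrite inE => /andP[HD /eqP HS] TN /eqP[H'E HE].
  have HU := dag_vset HD; have TSrc := subset_trans TN (subsetDl _ _).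
  have HrD : H \in D (U :\: T).
    by rewrite -HE; have [resD _] := sfD TU; apply: resD; rewrite inE HD.
  rewrite -(Aset_common sfD TU HrD) !inE HrD HD TN /= -H'E.
  have H'U : vset H' = U by rewrite -H'E.
  have H'T e : e \in eset H' -> src e \in T by rewrite -H'E inE => /andP[].
  rewrite -(Snk_star H'U (dag_vset HrD) H'T TN) HS eqxx !andbT.
  rewrite -[vset _]/(vset (star H' H)) HU eqxx /=.
  have -> : acyclicb (out_part T (star H' H)).
    by apply: acyclicb_subset (dag_acyclicb HD); apply/subsetP => e; rewrite inE => /andP[].
  apply/forall_inP => e; rewrite inE => /andP[eH eT].
  have /andP[_ tU] := incident_edge eH.
  rewrite eT inE -HU tU andbT; apply/negP => /(subsetP TSrc).
  by rewrite in_Src => /andP[_ /forall_inP/(_ e eH)]; rewrite eqxx.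
case/andP=> H'A; rewrite inE => /andP[HD /eqP HS].
have HU := dag_vset HD.
have := H'A; rewrite -(Aset_common sfD TU HD) inE => /and3P[].
rewrite inE => /andP[/eqP H'U _] /forall_inP H'T.
rewrite inE => /andP[sD TN].
have H'sT e : e \in eset H' -> src e \in T by case/H'T/andP.
by rewrite inE sD TN (Snk_star H'U HU H'sT TN) HS eqxx (out_part_star H'U HU) //
  (restrict_star HU) // eqxx.
Qed.

Lemma wts_D_Snk_rec S U :
  S \subset U -> S != U ->
  wts (D_Snk D S U)
    = \sum_(X : {set vertex G} | (S \subset X) && (X \proper U))
        wts (D_Snk D S X) * ((-1) ^+ (#|U :\: X| - 1)%N * A D (U :\: X) U).
Proof.
move=> SU nSU.
(* The inner sum of signs is 1. *)
transitivity (\sum_(H in D_Snk D S U)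
    \sum_(X : {set vertex G} | [&& S \subset X, X \proper U & U :\: X \subset Nss H])
      (-1) ^+ (#|U :\: X| - 1)%N * wt H).
  apply: eq_bigr => H; rewrite inE => /andP[HD /eqP HS].
  rewrite -big_distrl /= sum_sign_complements ?mul1r //.
    by apply: Nss_neq0 (dag_acyclicb HD) _; rewrite HS (dag_vset HD).
  by have := Nss_subset H; rewrite HS (dag_vset HD).
rewrite (exchange_big_dep (fun X => (S \subset X) && (X \proper U))) /=; last first.
  by move=> H X _ /and3P[-> ->].
apply: eq_bigr => X /andP[SX XU].
have XE : U :\: (U :\: X) = X by rewrite setDDr setDv set0U; apply/setIidPr/proper_sub.
rewrite mulrCA [_ * A _ _ _]mulrC -[in wts _]XE -wts_D_Snk_sources ?subsetDl // big_distrr /=.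
by apply: eq_bigl => H; rewrite SX XU.
Qed.

Lemma wts_D_Snk_diag U : wts (D_Snk D U U) = 1.
Proof.
have sUE : D_Snk D U U = [set edgeless U].
  apply/setP => H; rewrite !inE; apply/andP/eqP => [[HD /eqP HS] | ->].
    have HU := dag_vset HD; apply: subgraph_eq => //.
    by rewrite Snk_eq_vset ?HS ?HU.
  have [_ [_ ->]] := sfD (subxx U); split=> //.
  apply/eqP/setP => v; rewrite in_Snk andbC.
  by case: forall_inP => // -[] e; rewrite inE.
by rewrite /wts sUE big_set1 /wt big_set0.
Qed.

End Graphs.

Theorem corollary3p4 (G : digraph) (D : {set vertex G} -> {set subgraph G})
    (dagD : dag_assignment D) (sfD : source_factorizable D)
    (S U : {set vertex G}) (SU : S \subset U) :
  wts (D_Snk D S U)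
    = \sum_(c in chains S U) \prod_(1 <= l < (chain_length c).+1)
        ((-1) ^+ (#|chain_at c l :\: chain_at c l.-1| - 1)%N
         * A D (chain_at c l :\: chain_at c l.-1) (chain_at c l))
  /\
  \sum_(c in chains S U) \prod_(1 <= l < (chain_length c).+1)
      ((-1) ^+ (#|chain_at c l :\: chain_at c l.-1| - 1)%N
       * A D (chain_at c l :\: chain_at c l.-1) (chain_at c l))
    = \sum_(c in chains S U)
        (-1) ^+ (#|U :\: S| - chain_length c)%N
        * \prod_(1 <= l < (chain_length c).+1)
            A D (chain_at c l :\: chain_at c l.-1) (chain_at c l).
Proof.
split; last first.
  apply: eq_bigr => c /chain_sign_exponent <-.
  by rewrite big_split /= prodrXr.
pose a X Y : RE G := (-1) ^+ (#|Y :\: X| - 1)%N * A D (Y :\: X) Y.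
rewrite (sum_chains a S U).
apply: (@last_step_recursion_unique _ _ a _ S U (fun X => wts (D_Snk D S X))) => //;
  last exact: max_card.
move=> X SX _; case: eqVneq => [-> | XS]; first exact: wts_D_Snk_diag.
by apply: wts_D_Snk_rec; rewrite // eq_sym.
Qed.
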